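(* Let $\alpha\geq 0$, let $n,\beta$ be positive integers, and let $G$ be any simple graph of order $n$ with matching number $\beta$. Let $\rho_{\alpha}(G)$ denote the largest eigenvalue of $A_{\alpha}(G)=\alpha D(G)+A(G)$. (1) If $n=2\beta$ or $n=2\beta+1$, then $\rho_{\alpha}(G)\leq(\alpha+1)(n-1)$, with equality if and only if $G\cong K_{n}$. (2) If $2\beta+2\leq n<\frac{(2\alpha+3)\beta+\alpha+2}{\alpha+1}$, then $\rho_{\alpha}(G)\leq2(\alpha+1)\beta$, with equality if and only if $G\cong K_{2\beta+1}\cup\overline{K_{n-2\beta-1}}$. (3) If $n=\frac{(2\alpha+3)\beta+\alpha+2}{\alpha+1}$, then $\rho_{\alpha}(G)\leq2(\alpha+1)\beta$, with equality if and only if $G\cong K_{\beta}\vee\overline{K_{n-\beta}}$ or $G\cong K_{2\beta+1}\cup\overline{K_{n-2\beta-1}}$. (4) If $n>\frac{(2\alpha+3)\beta+\alpha+2}{\alpha+1}$, then \[ \rho_{\alpha}(G)\leq\frac{\alpha n+(\alpha+1)\beta-(\alpha+1)+\sqrt{\big[\alpha n+(\alpha+1)\beta-(\alpha+1)\big]^{2}-4\big[(\alpha^{2}-1)\beta n+(\alpha+1)\beta^{2}-\alpha(\alpha+1)\beta\big]}}{2}, \] with equality if and only if $G\cong K_{\beta}\vee\overline{K_{n-\beta}}$.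
   Context: All graphs are simple and undirected. The matching number $\beta(G)$ is the maximum size of a set of pairwise vertex-disjoint edges. $A(G)$ is the adjacency matrix and $D(G)$ the diagonal matrix of vertex degrees. $K_m$ is the complete graph on $m$ vertices, $\overline{K_m}$ the edgeless graph on $m$ vertices, $G_1\cup G_2$ the disjoint union, and $G_1\vee G_2$ the join (disjoint union plus all edges between $V(G_1)$ and $V(G_2)$). *)

(* Defs.v *)
From mathcomp Require Import all_boot all_order all_algebra.
From mathcomp Require Import spectral complex.
From mathcomp Require Import classical_sets reals.

Set Implicit Arguments.
Unset Strict Implicit.
Unset Printing Implicit Defensive.

Import Order.TTheory GRing.Theory Num.Theory.
Local Open Scope ring_scope.

Record sgraph := SGraph {
  vertex :> finType;
  adj : rel vertex;
  adj_sym : symmetric adj;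
  adj_irrefl : irreflexive adj }.

Definition order_of (G : sgraph) : nat := #|G|.

Definition graph_iso (G H : sgraph) : Prop :=
  exists2 f : G -> H, bijective f & forall x y, adj (f x) (f y) = adj x y.

Section Constructions.

Definition complete_adj m : rel 'I_m := fun x y => x != y.
Lemma complete_sym m : symmetric (@complete_adj m).
Proof. by move=> x y; rewrite /complete_adj eq_sym. Qed.
Lemma complete_irrefl m : irreflexive (@complete_adj m).
Proof. by move=> x; rewrite /complete_adj eqxx. Qed.
Definition complete_graph m : sgraph :=
  SGraph (@complete_sym m) (@complete_irrefl m).

Definition edgeless_adj m : rel 'I_m := fun _ _ => false.
Lemma edgeless_sym m : symmetric (@edgeless_adj m).
Proof. by []. Qed.
Lemma edgeless_irrefl m : irreflexive (@edgeless_adj m).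
Proof. by []. Qed.
Definition edgeless_graph m : sgraph :=
  SGraph (@edgeless_sym m) (@edgeless_irrefl m).

Variables G1 G2 : sgraph.

(* [cross] tells whether vertices on opposite sides are adjacent. *)
Definition sum_adj (cross : bool) : rel (G1 + G2)%type := fun u v =>
  match u, v with
  | inl x, inl y => adj x y
  | inr x, inr y => adj x y
  | _, _ => cross
  end.
Lemma sum_sym cross : symmetric (sum_adj cross).
Proof. by move=> [x|x] [y|y] //=; rewrite adj_sym. Qed.
Lemma sum_irrefl cross : irreflexive (sum_adj cross).
Proof. by move=> [x|x] /=; rewrite adj_irrefl. Qed.

Definition graph_union : sgraph :=
  SGraph (sum_sym false) (sum_irrefl false).
Definition graph_join : sgraph := SGraph (sum_sym true) (sum_irrefl true).

End Constructions.

Definition edges (G : sgraph) : {set {set G}} :=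
  [set e | [exists x, exists y, adj x y && (e == [set x; y])]].

Definition is_matching (G : sgraph) (M : {set {set G}}) : bool :=
  (M \subset edges G) && finset.trivIset M.

Definition matching_number (G : sgraph) : nat :=
  \max_(M : {set {set G}} | is_matching M) #|M|.

Definition degree (G : sgraph) (x : G) : nat := #|[set y | adj x y]|.

Section Spectrum.
Variable R : realType.

Definition adjacency_mx (G : sgraph) : 'M[R]_#|G| :=
  \matrix_(i, j) (adj (enum_val i) (enum_val j))%:R.

Definition degree_mx (G : sgraph) : 'M[R]_#|G| :=
  diag_mx (\row_i (degree (enum_val i))%:R).

Definition A_alpha (alpha : R) (G : sgraph) : 'M[R]_#|G| :=
  alpha *: degree_mx G + adjacency_mx G.

Definition is_largest_eigenvalue n (M : 'M[R]_n) (r : R) : Prop :=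
  eigenvalue M r /\ forall a, eigenvalue M a -> a <= r.

(* The value is meaningless (0) if [M] has no real eigenvalue; see
   [largest_eigenvalueP] for the symmetric case. *)
Definition largest_eigenvalue n (M : 'M[R]_n) : R :=
  xget 0 [set r | is_largest_eigenvalue M r]%classic.

Definition rho (alpha : R) (G : sgraph) : R :=
  largest_eigenvalue (A_alpha alpha G).

Lemma largest_eigenvalue_exists n (M : 'M[R]_n) :
  (0 < n)%N -> M^T = M -> exists r, is_largest_eigenvalue M r.
Proof.
move=> n0 Msym.
pose f : R -> R[i] := real_complex R.
have Mh : map_mx f M \is hermsymmx.
  apply: realsym_hermsym.
    apply/is_hermitianmxP; rewrite expr0 scale1r map_mx_id //.
    by apply/matrixP => i j; rewrite -{1}Msym !mxE.
  apply/mxOverP => i j; rewrite mxE /f complex_real //.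
have Dreal := hermitian_spectral_diag_real Mh.
have /orthomx_spectralP := hermitian_normalmx Mh.
have := spectral_unit (map_mx f M).
set P := spectralmx _; set D := spectral_diag _ in Dreal *.
move=> Pu Meq.
have evE a : eigenvalue M a <-> exists i, a = complex.Re (D 0 i).
  rewrite -(eigenvalue_map (real_complex R)) -/f.
  split.
    move=> /eigenvalueP [v vM v0].
    have wD : (v *m invmx P) *m diag_mx D = f a *: (v *m invmx P).
      by rewrite scalemxAl -vM Meq !mulmxA mulmxK.
    have w0 : v *m invmx P != 0.
      apply: contra_neq v0 => w0.
      by rewrite -(mulmxKV Pu v) w0 mul0mx.
    move: (v *m invmx P) w0 wD => w /rV0Pn [i wi] /rowP/(_ i).
    by rewrite mul_mx_diag !mxE mulrC => /(mulIf wi) Di; exists i; rewrite Di.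
  move=> [i ->].
  apply/eigenvalueP; exists (row i P).
    have Di : f (complex.Re (D 0 i)) = D 0 i by exact/RRe_real/(mxOverP Dreal).
    rewrite [X in X *: _]Di.
    rewrite {1}Meq -row_mul !mulmxA mulmxV // mul1mx row_mul.
    by rewrite row_diag_mx -scalemxAl -rowE.
  apply/eqP => r0; have : row_free P by rewrite row_free_unit.
  case/row_freeP => Q PQ; move: (congr1 (row i) PQ).
  rewrite row_mul r0 mul0mx => /rowP /(_ i).
  by rewrite !mxE eqxx => /eqP; rewrite eq_sym oner_eq0.
pose i0 := Ordinal n0.
exists (complex.Re (D 0 [arg max_(i > i0) complex.Re (D 0 i)]%O)).
case: arg_maxP => // i _ imax; split; first by apply/evE; exists i.
by move=> a /evE [j ->]; exact: imax.
Qed.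

Lemma largest_eigenvalueP n (M : 'M[R]_n) :
  (0 < n)%N -> M^T = M -> is_largest_eigenvalue M (largest_eigenvalue M).
Proof.
by move=> n0 Msym; apply: xgetPex; exact: largest_eigenvalue_exists.
Qed.

Lemma A_alpha_sym alpha G : (A_alpha alpha G)^T = A_alpha alpha G.
Proof.
rewrite /A_alpha linearD linearZ /= tr_diag_mx; congr (_ + _).
by apply/matrixP => i j; rewrite !mxE adj_sym.
Qed.

Lemma rhoP alpha (G : sgraph) :
  (0 < order_of G)%N -> is_largest_eigenvalue (A_alpha alpha G) (rho alpha G).
Proof. by move=> G0; apply: largest_eigenvalueP => //; exact: A_alpha_sym. Qed.

End Spectrum.

(* Main.v *)
(** The Tutte-Berge formula (proved through Gallai's lemma, by removing one by
    one the vertices covered by all maximum matchings) gives a set S of s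
    vertices and a partition of the other vertices into blocks without edges
    between distinct blocks, such that 2 s + sum (|B| - 1) <= 2 beta. If A is
    the alpha-matrix and w > 0 satisfies A w <= r w, then rho <= r
    (Collatz-Wielandt), and rho = r makes the inequality an equality on a
    nonempty union of connected components. For S empty take w = 1, so that
    r = 2 (alpha + 1) beta works. For S nonempty let w be 1 on S and, on a
    block of size k + 1, the value making the row inequality tight when the
    block is complete and joined to S; the rows of S then hold for
    r >= 2 (alpha + 1) beta as soon as they hold for s = beta, strictly if
    s < beta. For s = beta all blocks are singletons, and the row inequality
    of S is the quadratic inequality whose larger root is the bound of the
    last case. *)
Require Import Defs.
From mathcomp Require Import all_boot all_order all_algebra.
From mathcomp Require Import reals ring lra zify.

Set Implicit Arguments.
Unset Strict Implicit.
Unset Printing Implicit Defensive.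

Import Order.TTheory GRing.Theory Num.Theory.
Local Open Scope ring_scope.

(** * Matchings and the Tutte-Berge barrier *)

Section Pairings.
Local Open Scope nat_scope.
Variable G : sgraph.
Implicit Types (U V S : {set G}) (f M N : {ffun G -> G}) (x y u v t : G).

(* Matchings are encoded as the involutions exchanging the ends of each edge;
   missed vertices are fixed. *)
Definition pairing U f :=
  [forall x, (f (f x) == x) && ((f x != x) ==> adj x (f x) && (x \in U))].

Definition covered f : {set G} := [set x | f x != x].

Lemma pairingP U f :
  reflect (involutive f /\ forall x, f x != x -> adj x (f x) /\ x \in U)
          (pairing U f).
Proof.
apply: (iffP forallP) => [h | [fK h] x].
  split=> [x | x fx]; have /andP[/eqP fK /implyP hx] := h x; first exact: fK.
  by have /andP[] := hx fx.
rewrite fK eqxx /=; apply/implyP => fx.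
by have [-> ->] := h x fx.
Qed.

Lemma pairing_sub U V f : U \subset V -> pairing U f -> pairing V f.
Proof.
move=> /subsetP UV /pairingP[fK h]; apply/pairingP; split=> // x fx.
by have [? /UV] := h x fx.
Qed.

Lemma covered_matching U f :
  pairing U f -> exists2 E : {set {set G}}, is_matching E & #|covered f| = 2 * #|E|.
Proof.
move=> /pairingP[fK h].
pose E := [set [set x; f x] | x in covered f].
have part : partition E (covered f).
  have sub x : x \in covered f -> [set x; f x] \subset covered f.
    rewrite inE => fx; apply/subsetP => y; rewrite !inE.
    by case/orP => /eqP -> //; rewrite fK eq_sym.
  apply/and3P; split.
  - rewrite /cover eqEsubset; apply/andP; split.
      by apply/bigcupsP => B /imsetP[x xc ->]; apply: sub.
    apply/subsetP => x xc; apply/bigcupP; exists [set x; f x].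
      by apply/imsetP; exists x.
    by rewrite !inE eqxx.
  - apply/trivIsetP => A B /imsetP[x _ ->] /imsetP[y _ ->].
    apply: contraR => /pred0Pn[z /=]; rewrite !inE.
    case/andP=> /orP[/eqP->|/eqP->] /orP[/eqP e|/eqP e].
    + by rewrite e.
    + by rewrite e fK setUC.
    + by rewrite -e fK setUC.
    + by rewrite (can_inj fK e).
  - apply/imsetP => -[x _ e].
    by have := in_set0 x; rewrite e !inE eqxx.
exists E.
  apply/andP; split; last by case/and3P: part.
  apply/subsetP => B /imsetP[x]; rewrite inE => fx ->.
  rewrite inE; apply/existsP; exists x; apply/existsP; exists (f x).
  by have [-> _] := h x fx; rewrite eqxx.
rewrite (@card_uniform_partition _ 2 E _ _ part) 1?mulnC //.
by move=> B /imsetP[x]; rewrite inE => fx ->; rewrite cards2 eq_sym fx.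
Qed.

(* Counts covered vertices: twice the matching number. *)
Definition pairing_number U := \max_(f | pairing U f) #|covered f|.

Definition max_pairing U f := pairing U f && (#|covered f| == pairing_number U).

Lemma max_pairing_exists U : exists f, max_pairing U f.
Proof.
have id_pairing : pairing U [ffun x => x].
  by apply/pairingP; split=> x; rewrite !ffunE ?eqxx.
rewrite /max_pairing /pairing_number (bigop.bigmax_eq_arg _ id_pairing).
by case: arg_maxnP => // f pf _; exists f; rewrite pf eqxx.
Qed.

Lemma pairing_number_max U f : pairing U f -> #|covered f| <= pairing_number U.
Proof. exact: leq_bigmax_cond. Qed.

Lemma pairing_number_matching U : pairing_number U <= 2 * matching_number G.
Proof.
apply/bigmax_leqP => f /covered_matching[E mE ->].
by rewrite leq_mul2l /= /matching_number (leq_bigmax_cond _ mE).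
Qed.

Lemma pairing_number_even U : ~~ odd (pairing_number U).
Proof.
have [f /andP[/covered_matching[E _ cE] /eqP <-]] := max_pairing_exists U.
by rewrite cE oddM.
Qed.

(** Meant for [x] missed by [f]: the edge of [f] at [y], if any, is exchanged for [xy], and the
    former partner of [y] becomes missed. *)
Definition repair f x y : {ffun G -> G} :=
  [ffun w => if w == x then y else if w == y then x
             else if w == f y then w else f w].

Lemma repair_pairing U f x y : pairing U f -> adj x y -> x \in U -> y \in U ->
  f x = x -> pairing U (repair f x y).
Proof.
move=> /pairingP[fK h] xy xU yU fx; have yx : y != x.
  by apply: contraTneq xy => ->; rewrite adj_irrefl.
apply/pairingP; split=> w; rewrite !ffunE.
  have [->|wx] := eqVneq w x; first by rewrite (negPf yx) eqxx.
  have [->|wy] := eqVneq w y; first by rewrite eqxx.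
  have [e0|wfy] := eqVneq w (f y).
    rewrite e0; have [e|n1] := eqVneq (f y) x; first by rewrite -(fK y) e fx eqxx in yx.
    have [e|n2] := eqVneq (f y) y; last by rewrite eqxx.
    by rewrite e0 e eqxx in wy.
  have [e|n1] := eqVneq (f w) x; first by rewrite -(fK w) e fx eqxx in wx.
  have [e|n2] := eqVneq (f w) y; first by rewrite -e fK eqxx in wfy.
  have [e|n3] := eqVneq (f w) (f y); last exact: fK.
  by rewrite (can_inj fK e) eqxx in wy.
have [-> _|wx] := eqVneq w x; first by [].
have [-> _|wy] := eqVneq w y; first by rewrite adj_sym.
by have [_|wfy] := eqVneq w (f y); [rewrite eqxx | apply: h].
Qed.

(** With both ends of an edge missed, [repair] would merely add that edge and cover two more
    vertices. *)
Lemma max_pairing_adj U f x y : max_pairing U f -> adj x y -> x \in U ->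
  y \in U -> f x = x -> f y <> y.
Proof.
move=> /andP[pf /eqP cf] xy xU yU fx fy.
have := pairing_number_max (repair_pairing pf xy xU yU fx).
rewrite -cf leqNgt => /negP; apply; apply: proper_card; apply/properP; split.
  apply/subsetP => w; rewrite !inE !ffunE fy.
  have [->|wx] := eqVneq w x; first by rewrite fx eqxx.
  by have [->|wy] := eqVneq w y; first by rewrite fy eqxx.
exists x; rewrite !inE ?ffunE fx ?eqxx //.
by apply: contraTneq xy => ->; rewrite adj_irrefl.
Qed.

(* Gallai's lemma. Choose [N] missing [t] and sharing as many edges as possible
   with [M]; [M] covers some [x != t] missed by [N], and pairing [x] in [N] with
   its [M]-partner increases the number of shared edges. *)
Lemma gallai U M t u v : u != v ->
  max_pairing U M -> M u = u -> M v = v ->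
  (exists2 N, max_pairing U N & N t = t) ->
  (forall N, max_pairing U N -> N t = t -> N u != u /\ N v != v) ->
  M t = t.
Proof.
move=> uv maxM Mu Mv [N0 maxN0 N0t] hN; apply/eqP/negPn/negP => Mt.
pose agree N := #|[set x | (M x == N x) && (M x != x)]|.
have P0 : max_pairing U N0 && (N0 t == t) by rewrite maxN0 N0t eqxx.
case: (@arg_maxnP _ N0 (fun N => max_pairing U N && (N t == t)) agree P0).
move=> N /andP[maxN /eqP Nt] Nmax.
have [Nu Nv] := hN N maxN Nt.
have [/andP[pM /eqP cM] /andP[pN /eqP cN]] := (maxM, maxN).
(* [M] and [N] cover equally many vertices, and [N] covers [u] and [v], which [M] misses. So [M]
   covers at least two vertices missed by [N], one of them different from [t]. *)
have [x] : exists2 x, x \in covered M :\: covered N & x != t.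
  have cNM : 2 <= #|covered N :\: covered M|.
    rewrite -[2]/((true : nat).+1) -uv -cards2 subset_leq_card //.
    by apply/subsetP => w; rewrite !inE => /orP[] /eqP->; rewrite ?Mu ?Mv eqxx ?Nu ?Nv.
  have : 2 <= #|covered M :\: covered N|.
    have := cardsID (covered N) (covered M); have := cardsID (covered M) (covered N).
    rewrite setIC; lia.
  move=> c2; have : 0 < #|(covered M :\: covered N) :\ t|.
    by have := cardsD1 t (covered M :\: covered N); case: (_ \in _); lia.
  by case/card_gt0P => x; rewrite in_setD1 => /andP[? ?]; exists x.
rewrite !inE negbK => /andP[/eqP Nx Mx] xt.
have [/pairingP[MK hM] /pairingP[NK hNp]] := (pM, pN).
have [xy xU] := hM x Mx; set y := M x in xy.
have yU : y \in U by have [] := hM y; rewrite /y ?MK // eq_sym.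
have Ny : N y != y by apply/eqP/(max_pairing_adj maxN xy).
have yx : y != x by [].
have Nyx : N y != x by apply: contra_neq yx => e; rewrite -(NK y) e.
have pN' := repair_pairing pN xy xU yU Nx.
set N' := repair N x y in pN'.
have cN' : #|covered N'| = #|covered N|.
  have -> : covered N' = x |: (covered N :\ N y).
    apply/setP => w; rewrite !inE !ffunE.
    have [->|wx] := eqVneq w x; first by rewrite yx.
    have [->|wy] := eqVneq w y; first by rewrite eq_sym yx eq_sym Ny.
    by have [->|wNy] := eqVneq w (N y); rewrite ?eqxx.
  rewrite cardsU1 !inE Nx eqxx andbF /= [RHS](cardsD1 (N y)) !inE NK.
  by rewrite eq_sym Ny.
have /(Nmax N') : max_pairing U N' && (N' t == t).
  rewrite /max_pairing pN' cN' cN eqxx /= !ffunE.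
  have [e|tx] := eqVneq t x; first by rewrite e eqxx in xt.
  have [e|ty] := eqVneq t y; first by rewrite -e Nt eqxx in Ny.
  by rewrite Nt; case: ifP.
(* The new edge [xy] is shared with [M]; the edge of [N] lost at [y] was not, since [N y] differs
   from [x = M y]. *)
apply/negP; rewrite -ltnNge; apply: proper_card; apply/properP; split.
  apply/subsetP => w; rewrite !inE !ffunE => /andP[/eqP MN Mw]; rewrite Mw andbT.
  have [e|wx] := eqVneq w x; first by rewrite MN e Nx eqxx in Mw.
  have [e|wy] := eqVneq w y; first by move: Nyx; rewrite -e -MN e /y MK eqxx.
  have [e|wNy] := eqVneq w (N y); last by rewrite MN.
  have e' := MK w; rewrite MN e NK /y MK in e'.
  by rewrite /y -e' eqxx in Nyx.
by exists x; rewrite !inE ?ffunE ?eqxx //= Nx (negPf Mx).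
Qed.

(** Induction on the size of [U]. A vertex covered by all maximum pairings goes into [S]. If there
    is none, [S] is empty and the blocks are the classes of the relation of never being missed
    together. *)
Lemma barrier_in U : exists (S : {set G}) (P : {set {set G}}),
  [/\ S \subset U, partition P (U :\: S),
      {in U :\: S &, forall x y, adj x y -> pblock P x = pblock P y}
    & 2 * #|S| + \sum_(B in P) #|B|.-1 <= pairing_number U].
Proof.
have [k] := ubnP #|U|; elim: k U => // k IH U Uk.
have [/exists_inP[v vU /forall_inP cv]|/exists_inPn missed] :=
  boolP [exists v in U, [forall (f | max_pairing U f), f v != v]].
  have [|S [P [SU part adjP card]]] := IH (U :\ v).
    by have := cardsD1 v U; rewrite vU; lia.
  have vS : v \notin S.
    by apply/negP => /(subsetP SU); rewrite !inE eqxx.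
  have eD : U :\: (v |: S) = (U :\ v) :\: S by rewrite setDDl.
  exists (v |: S), P; split; rewrite ?eD //.
    by rewrite subUset sub1set vU (subset_trans SU) ?subD1set.
  (* A maximum pairing of [U :\ v] misses [v], so it is not maximum in [U]. By parity the number
     drops by at least 2, which pays for [v]. *)
  have lt : pairing_number (U :\ v) < pairing_number U.
    have [f /andP[pf /eqP cf]] := max_pairing_exists (U :\ v).
    have pfU := pairing_sub (subD1set U v) pf.
    rewrite -cf ltn_neqAle pairing_number_max // andbT.
    apply/negP => c; have := cv f; rewrite /max_pairing pfU c => /(_ isT) fv.
    by have /pairingP[_ /(_ v fv)[_]] := pf; rewrite !inE eqxx.
  have := pairing_number_even U; have := pairing_number_even (U :\ v).
  by rewrite cardsU1 vS; lia.
have missing v : v \in U -> exists2 f, max_pairing U f & f v = v.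
  move=> /missed; rewrite negb_forall_in => /exists_inP[f mf /negPn/eqP fv].
  by exists f.
pose R u v := (u == v) || [forall (f | max_pairing U f), (f u != u) || (f v != v)].
have RP u v : u != v -> R u v -> forall f, max_pairing U f -> f u = u -> f v != v.
  move=> uv; rewrite /R (negPf uv) /= => /forall_inP h f /h.
  by case/orP => // /negP + e; rewrite e eqxx.
have Rsym u v : R u v = R v u.
  by rewrite /R eq_sym; congr orb; apply: eq_forallb => f; rewrite orbC.
have Requiv : {in U & &, equivalence_rel R}.
  (* By [gallai], a maximum pairing missing both [u] and [w] would also miss [v], contrary to
     [R u v]. *)
  have trans u v w : v \in U -> R u v -> R v w -> R u w.
    move=> vU; have [->//|uv] := eqVneq u v; have [->//|vw] := eqVneq v w.
    move=> Ruv Rvw; have [->|uw] := eqVneq u w; first by rewrite /R eqxx.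
    apply/orP; right; apply/forall_inP => f mf; rewrite -negb_and.
    apply/negP => /andP[/eqP fu /eqP fw].
    have := RP _ _ uv Ruv f mf fu; rewrite (gallai uw mf fu fw (missing v vU)) ?eqxx //.
    move=> N mN Nv; split; last exact: (RP v w).
    by apply: (RP v u) => //; rewrite 1?eq_sym // Rsym.
  move=> u v w uU vU wU; split; first by rewrite /R eqxx.
  move=> Ruv; apply/idP/idP; last exact: trans.
  by apply: (trans v u w) => //; rewrite Rsym.
have part := equivalence_partitionP Requiv.
exists set0, (equivalence_partition R U); rewrite setD0; split=> //.
- exact: sub0set.
- move=> x y xU yU xy.
  have yB : y \in pblock (equivalence_partition R U) x.
    rewrite pblock_equivalence_partition //; apply/orP; right.
    apply/forall_inP => f mf; have [fx|//] := eqVneq (f x) x.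
    by apply/eqP/(max_pairing_adj mf xy).
  by rewrite (same_pblock _ yB) //; case/and3P: part.
rewrite cards0 add0n.
have [f /andP[pf /eqP cf]] := max_pairing_exists U.
have sub : covered f \subset U.
  by apply/subsetP => x; rewrite inE; have /pairingP[_ h] := pf => /h[].
have count (A : {set G}) : \sum_(x in A) (f x != x) = #|A :&: covered f|.
  rewrite -sum1_card [RHS](eq_bigl (fun x => (x \in A) && (f x != x))).
    by rewrite big_mkcondr; apply: eq_bigr => x _; case: (_ != _).
  by move=> x; rewrite !inE.
rewrite -cf -(setIidPr sub) -count (set_partition_big _ part); apply: leq_sum => B PB.
rewrite count.
have [_ tI _] := and3P part.
(* Related vertices are not missed together, so [f] covers all vertices of a class except at most
   one. *)
have : #|B :\: covered f| <= 1.
  apply/card_le1_eqP => x y; rewrite !inE !negbK => /andP[/eqP fx xB] /andP[/eqP fy yB].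
  have BU : {subset B <= U}.
    by move=> z zB; rewrite -(cover_partition part); apply/bigcupP; exists B.
  have : R x y by rewrite -(pblock_equivalence_partition Requiv) ?BU // (def_pblock tI PB).
  have [//|xy] := eqVneq y x.
  by move/RP => /(_ _ f _ fx); rewrite fy eqxx /max_pairing pf cf eqxx eq_sym xy => /(_ isT isT).
by have := cardsID (covered f) B; lia.
Qed.

Lemma barrier : exists (S : {set G}) (P : {set {set G}}),
  [/\ partition P (~: S),
      {in ~: S &, forall x y, adj x y -> pblock P x = pblock P y}
    & 2 * #|S| + \sum_(B in P) #|B|.-1 <= 2 * matching_number G].
Proof.
have [S [P [_]]] := barrier_in setT; rewrite setTD => part adjP card.
exists S, P; split=> //; exact: leq_trans card (pairing_number_matching _).
Qed.

End Pairings.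

(** * Eigenvalue bounds from positive weights *)

Section AlphaAction.
Variables (R : realType) (alpha : R) (G : sgraph).
Implicit Types (phi w : G -> R) (r : R).

(** The action of [A_alpha] on functions on the vertices; the summand [alpha * phi x], taken once
    per neighbour, gives the degree term. *)
Definition alpha_act phi (x : G) : R := \sum_(y | adj x y) (alpha * phi x + phi y).

Lemma mulmx_A_alpha phi j :
  ((\row_i phi (enum_val i)) *m A_alpha alpha G) 0 j = alpha_act phi (enum_val j).
Proof.
rewrite !mxE /alpha_act big_split /= sumr_const.
under eq_bigr => i _ do rewrite !mxE mulrDr.
rewrite big_split /=; congr (_ + _).
  rewrite (bigD1 j) //= eqxx mulr1n big1 ?addr0.
    by rewrite mulrCA mulrA mulr_natr /degree cardsE.
  by move=> i /negPf ->; rewrite mulr0n !mulr0.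
rewrite -(big_enum_val (A := G) (fun y => phi y * (adj y (enum_val j))%:R)) /=.
rewrite [RHS]big_mkcond /=; apply: eq_bigr => y _.
by rewrite adj_sym; case: ifP; rewrite ?mulr1 ?mulr0.
Qed.

Lemma eigenvalue_A_alphaP r :
  eigenvalue (A_alpha alpha G) r <->
  exists2 phi, exists x, phi x != 0 & forall x, alpha_act phi x = r * phi x.
Proof.
split=> [/eigenvalueP[v vA /rV0Pn[i vi]] | [phi [x phix] act]].
  pose phi x := v 0 (enum_rank x).
  have ve : v = \row_i phi (enum_val i).
    by apply/rowP => j; rewrite mxE /phi enum_valK.
  exists phi; first by exists (enum_val i); rewrite /phi enum_valK.
  move=> x; have := mulmx_A_alpha phi (enum_rank x).
  by rewrite -ve vA !mxE enum_rankK => <-.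
apply/eigenvalueP; exists (\row_i phi (enum_val i)).
  by apply/rowP => j; rewrite mulmx_A_alpha act !mxE.
by apply/rV0Pn; exists (enum_rank x); rewrite mxE enum_rankK.
Qed.

(* Collatz--Wielandt bound; the set [Z] consists of the vertices where the
   ratio of an eigenfunction to [w] is maximal. *)
Lemma rho_le_weight w r : (0 < #|G|)%N -> (forall x, 0 < w x) ->
  (forall x, alpha_act w x <= r * w x) ->
  rho alpha G <= r /\
  (rho alpha G = r -> exists Z : {set G},
    [/\ Z != set0, forall x y, x \in Z -> adj x y -> y \in Z
      & {in Z, forall x, alpha_act w x = r * w x}]).
Proof.
move=> G0 w0 wr; have [/eigenvalue_A_alphaP[phi [x0 phix0] act] _] := rhoP alpha G0.
set a := rho alpha G in act *.
(* Up to sign the eigenfunction is positive somewhere, so its maximal ratio to [w] is positive. *)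
wlog {phix0} phix0 : phi act / 0 < phi x0.
  move=> wl; have [lt|gt|e] := ltgtP (phi x0) 0; last by rewrite e eqxx in phix0.
  - apply: (wl (fun x => - phi x)); last by rewrite oppr_gt0.
    move=> x; rewrite mulrN -act /alpha_act -sumrN; apply: eq_bigr => y _; ring.
  - exact: (wl phi).
case: (@Order.TotalTheory.arg_maxP _ _ _ x0 xpredT (fun x => phi x / w x) isT).
move=> x1 _ max; set c := phi x1 / w x1.
have c_gt0 : 0 < c by apply: lt_le_trans (max x0 isT); rewrite divr_gt0.
have le_c x : phi x <= c * w x by rewrite -ler_pdivrMr //; apply: max.
have e1 : phi x1 = c * w x1 by rewrite /c divfK // gt_eqF.
have act_le x : phi x = c * w x -> alpha_act phi x <= c * alpha_act w x.
  move=> e; rewrite /alpha_act mulr_sumr; apply: ler_sum => y _.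
  by rewrite e; have := le_c y; lra.
have a_le : a <= r.
  have phi1 : 0 < phi x1 by rewrite e1 mulr_gt0.
  rewrite -(ler_pM2r phi1) -act (le_trans (act_le _ e1)) //.
  by rewrite e1 mulrCA ler_pM2l.
split=> // ar; exists [set x | phi x == c * w x]; split.
- by apply/set0Pn; exists x1; rewrite inE; apply/eqP.
- move=> x y; rewrite !inE => /eqP ex xy.
  (* The terms are nonnegative by maximality of [c], and their sum is nonpositive because [a = r].
     So they all vanish and the neighbours of [x] attain the maximal ratio too. *)
  have : \sum_(z | adj x z) (c * w z - phi z) <= 0.
    have -> : \sum_(z | adj x z) (c * w z - phi z) = c * alpha_act w x - alpha_act phi x.
      rewrite /alpha_act mulr_sumr -sumrB; apply: eq_bigr => z _; rewrite ex; ring.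
    by rewrite subr_le0 act ar ex mulrCA ler_pM2l.
  rewrite (bigD1 y) //= => le0.
  have : 0 <= \sum_(z | adj x z && (z != y)) (c * w z - phi z).
    by apply: sumr_ge0 => z _; rewrite subr_ge0.
  by have := le_c y; rewrite eq_le; lra.
- move=> x; rewrite inE => /eqP ex; apply/eqP; rewrite eq_le wr /=.
  by rewrite -(ler_pM2l c_gt0) mulrCA -ex -ar -act act_le.
Qed.

Lemma rho_eq phi r : rho alpha G <= r -> (exists x, phi x != 0) ->
  (forall x, alpha_act phi x = r * phi x) -> rho alpha G = r.
Proof.
move=> le [x phix] act; apply/eqP; rewrite eq_le le /=.
have G0 : (0 < #|G|)%N by apply/card_gt0P; exists x.
have [_ ->//] := rhoP alpha G0.
by apply/eigenvalue_A_alphaP; exists phi => //; exists x.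
Qed.

Lemma alpha_act1 x : alpha_act (fun=> 1) x = (alpha + 1) * (degree x)%:R.
Proof. by rewrite /alpha_act sumr_const mulr1 /degree cardsE mulr_natr. Qed.

End AlphaAction.

(** * Vertex-set descriptions of the extremal graphs *)

Section Isomorphisms.
Local Open Scope nat_scope.
Variable G : sgraph.

Lemma bij_sum_of_set (C : {set G}) a b : #|C| = a -> #|~: C| = b ->
  exists2 f : G -> 'I_a + 'I_b, bijective f &
    forall x, (x \in C) = (if f x is inl _ then true else false).
Proof.
move=> <- <-.
pose g (u : 'I_#|C| + 'I_#|~: C|) : G :=
  match u with inl i => enum_val i | inr j => enum_val j end.
have gC u : (g u \in C) = (if u is inl _ then true else false).
  by case: u => i /=; have := enum_valP i; rewrite ?inE // => /negPf.
have g_inj : injective g.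
  move=> u v e; have := gC u; rewrite e gC.
  case: u v e => i [j|j] //= /enum_val_inj -> //.
have [|f fK gK] := inj_card_bij g_inj; first by rewrite card_sum !card_ord cardsC.
by exists f => [|x]; [exists g | rewrite -gC gK].
Qed.

Lemma complete_isoP n : #|G| = n ->
  graph_iso G (complete_graph n) <-> forall x y : G, adj x y = (x != y).
Proof.
move=> Gn; split=> [[f fb fadj] x y | adjE].
  by rewrite -fadj /= /complete_adj (bij_eq fb).
have fb : bijective (fun x : G => cast_ord Gn (enum_rank x)).
  exists (fun i => enum_val (cast_ord (esym Gn) i)) => x.
    by rewrite cast_ordK enum_rankK.
  by rewrite enum_valK cast_ordKV.
by exists (fun x => cast_ord Gn (enum_rank x)) => // x y; rewrite adjE -(bij_eq fb).
Qed.

Lemma card_preim_inl a b (f : G -> 'I_a + 'I_b) : bijective f ->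
  #|[set x | if f x is inl _ then true else false]| = a.
Proof.
move=> [g fK gK].
have -> : [set x | if f x is inl _ then true else false] =
          g @: [set inl i | i in 'I_a].
  apply/setP => x; rewrite inE; apply/idP/imsetP => [|[u /imsetP[i _ ->] ->]].
    case e : (f x) => [i|//] _; exists (inl i); last by rewrite -e fK.
    by apply/imsetP; exists i.
  by rewrite gK.
rewrite card_imset; last exact: can_inj gK.
by rewrite card_imset ?card_ord // => i j [].
Qed.

(** The equality analysis produces such a set [S], and the eigenfunction of the join is defined from
    it. *)
Lemma complete_join_isoP a b : #|G| = a + b ->
  graph_iso G (graph_join (complete_graph a) (edgeless_graph b)) <->
  exists2 S : {set G}, #|S| = a &
    forall x y, adj x y = (x != y) && ((x \in S) || (y \in S)).
Proof.
move=> Gab; split=> [[f fb fadj] | [S Sa adjE]].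
  pose S := [set x | if f x is inl _ then true else false].
  exists S => [|x y]; first exact: card_preim_inl.
  rewrite -fadj -(bij_eq fb) !inE /= /complete_adj /edgeless_adj.
  by case: (f x) (f y) => i [j|j] //=; rewrite ?andbT ?andbF // (inj_eq inl_inj).
have [|f fb fS] := bij_sum_of_set (a := a) (b := b) Sa.
  by have := cardsC S; lia.
exists f => // x y; rewrite adjE -(bij_eq fb) !fS /= /complete_adj /edgeless_adj.
by case: (f x) (f y) => i [j|j] //=; rewrite ?andbT ?andbF // (inj_eq inl_inj).
Qed.

Lemma complete_union_isoP a b : #|G| = a + b ->
  graph_iso G (graph_union (complete_graph a) (edgeless_graph b)) <->
  exists2 C : {set G}, #|C| = a &
    forall x y, adj x y = [&& x != y, x \in C & y \in C].
Proof.
move=> Gab; split=> [[f fb fadj] | [S Sa adjE]].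
  pose S := [set x | if f x is inl _ then true else false].
  exists S => [|x y]; first exact: card_preim_inl.
  rewrite -fadj -(bij_eq fb) !inE /= /complete_adj /edgeless_adj.
  by case: (f x) (f y) => i [j|j] //=; rewrite ?andbT ?andbF // (inj_eq inl_inj).
have [|f fb fS] := bij_sum_of_set (a := a) (b := b) Sa.
  by have := cardsC S; lia.
exists f => // x y; rewrite adjE -(bij_eq fb) !fS /= /complete_adj /edgeless_adj.
by case: (f x) (f y) => i [j|j] //=; rewrite ?andbT ?andbF // (inj_eq inl_inj).
Qed.

End Isomorphisms.

(** * The row inequality for barriers with fewer than [b] vertices *)

(** Here [s] is the size of the barrier and [n] the order. [K] bounds a block size minus one, [E] is
    the least denominator of a weight, and the left side bounds a row of the barrier. The last
    hypothesis is this row inequality for [s = b], cleared of its denominator. *)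
Lemma weight_sum_lt (R : realFieldType) (a s b n r : R) :
  let D := r - a * s in let K := 2 * (b - s) in let E := D - (a + 1) * K in
  0 <= a -> 1 <= s -> s + 1 <= b -> 2 * b + 1 <= n -> 2 * (a + 1) * b <= r ->
  b * (n - b) <= (r - a * (n - 1) - (b - 1)) * (r - a * b) ->
  a * (n - 1) + (s - 1) + ((n - s) * s / D + s * (a + 1) / (D * E) * (K * (K + 1))) < r.
Proof.
move=> D K E a0 s1 sb nb rb ineq.
have Db : r - a * b <= D by rewrite /D; nra.
have rb0 : 0 < r - a * b by nra.
have D0 : 0 < D by lra.
have E_ge : (a + 2) * s <= E by rewrite /E /K /D; nra.
have as0 : 0 < (a + 2) * s by nra.
have E0 : 0 < E by lra.
set t := b - s; have t1 : 1 <= t by rewrite /t; lra.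
(* The two sides differ by the factor [2 * s / E], at most 1 by [E_ge]. *)
have second : s * (a + 1) / (D * E) * (K * (K + 1)) <= t * ((a + 1) * (2 * t + 1)) / D.
  have -> : s * (a + 1) / (D * E) * (K * (K + 1)) =
     t * ((a + 1) * (2 * t + 1)) / D * (2 * s / E).
    by rewrite /K /t; field; rewrite !gt_eqF.
  rewrite ler_piMr ?ler_pdivrMr //; last by nra.
  by apply: divr_ge0; [nra | exact: ltW].
have last_row : b * (n - b) / D <= r - a * (n - 1) - (b - 1).
  have : b * (n - b) / (r - a * b) <= r - a * (n - 1) - (b - 1) by rewrite ler_pdivrMr.
  apply: le_trans; rewrite ler_wpM2l ?lef_pV2 ?posrE //.
  by rewrite mulr_ge0; lra.
(* After multiplication by [D] the terms [(n - s) * s] cancel and a factor [t] splits off. *)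
have main : ((n - s) * s + t * ((a + 1) * (2 * t + 1))) / D < t + b * (n - b) / D.
  rewrite ltr_pdivrMr // [ltRHS]mulrDl divfK ?gt_eqF //.
  have -> : b * (n - b) = (n - s) * s + t * (n - b - s) by rewrite /t; ring.
  have : (a + 1) * (2 * t + 1) < D + (n - b - s) by rewrite /D /t; nra.
  have t0 : 0 < t by lra.
  by rewrite -(ltr_pM2l t0); clearbody D t; lra.
have tE : t = b - s by [].
by move: main; rewrite mulrDl; clearbody D E K t; lra.
Qed.

(** * Bounds on rho from a given barrier *)

Section BarrierBounds.
Variables (R : realType) (alpha : R) (G : sgraph) (b : nat) (r : R).
Variables (S : {set G}) (P : {set {set G}}).
Hypothesis alpha_ge0 : 0 <= alpha.
Hypothesis r_ge : 2 * (alpha + 1) * b%:R <= r.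
Hypothesis part : partition P (~: S).
Hypothesis adjP : {in ~: S &, forall x y, adj x y -> pblock P x = pblock P y}.
Hypothesis excess : (2 * #|S| + \sum_(B in P) #|B|.-1 <= 2 * b)%N.

Let k x := #|pblock P x|.-1.

(** The sum equals that of [|B| * (|B| - 1)] over the blocks. By [excess] the numbers [|B| - 1] add
    up to at most [2 * (b - |S|)], which therefore also bounds each of them. *)
Lemma k_sum : (\sum_(x in ~: S) k x <= (2 * (b - #|S|)) * (2 * (b - #|S|)).+1)%N.
Proof.
have [_ tI _] := and3P part.
have sumE : (\sum_(x in ~: S) k x = \sum_(B in P) #|B| * #|B|.-1)%N.
  rewrite (set_partition_big _ part) /=; apply: eq_bigr => B PB.
  by rewrite -sum_nat_const; apply: eq_bigr => x xB; rewrite /k (def_pblock tI PB).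
have le B : B \in P -> (#|B|.-1 <= 2 * (b - #|S|))%N.
  by move=> PB; move: excess; rewrite (bigD1 B PB) /=; lia.
rewrite sumE (leq_trans (n := (\sum_(B in P) (2 * (b - #|S|)).+1 * #|B|.-1)%N)) //.
  by apply: leq_sum => B /le; rewrite leq_mul2r; lia.
rewrite -big_distrr /= [leqRHS]mulnC leq_mul2l; apply/orP; right; move: excess.
by set q := bigop _ _ _; clearbody q; lia.
Qed.

Lemma pblock_mem x : x \in ~: S -> (x \in pblock P x) && (pblock P x \in P).
Proof. by move=> xS; rewrite mem_pblock pblock_mem ?(cover_partition part) // xS. Qed.

Lemma k_le x : x \in ~: S -> (k x <= 2 * (b - #|S|))%N.
Proof.
move=> /pblock_mem /andP[_ PB]; move: excess.
by rewrite (bigD1 (pblock P x)) //= /k; lia.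
Qed.

Lemma barrier_le : (#|S| <= b)%N.
Proof. by move: excess; lia. Qed.

Lemma nbr_outside x : x \in ~: S ->
  [set y | adj x y] :&: ~: S \subset pblock P x :\ x.
Proof.
move=> xS; apply/subsetP => y; rewrite in_setI in_setD1 inE => /andP[xy yS].
rewrite (adjP xS yS xy); have [-> _] := andP (pblock_mem yS).
by rewrite andbT; apply: contraTneq xy => ->; rewrite adj_irrefl.
Qed.

Lemma card_nbr_outside x : x \in ~: S -> (#|[set y | adj x y] :&: ~: S| <= k x)%N.
Proof.
move=> xS; apply: leq_trans (subset_leq_card (nbr_outside xS)) _.
by have := cardsD1 x (pblock P x); have [-> _] := andP (pblock_mem xS); rewrite /k; lia.
Qed.

(** With weight 1 a row is [alpha + 1] times a degree, and degrees are at most [2 * b]. In case of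
    equality all degrees in [Z] are [2 * b], so the block of a vertex of [Z] is a clique of
    [2 * b + 1] vertices. *)
Lemma rho_barrier0 : (0 < #|G|)%N -> (0 < b)%N -> S = set0 ->
  rho alpha G <= r /\
  (rho alpha G = r -> r = 2 * (alpha + 1) * b%:R /\
   exists2 C : {set G}, #|C| = (2 * b + 1)%N &
     forall x y, adj x y = [&& x != y, x \in C & y \in C]).
Proof.
move=> G0 b0 S0.
have xS x : x \in ~: S by rewrite S0 inE in_set0.
have deg_le (x : G) : (degree x <= k x)%N.
  by have := card_nbr_outside (xS x); rewrite S0 setC0 setIT.
have k2b x : (k x <= 2 * b)%N by have := k_le (xS x); lia.
have deg2b (x : G) : (degree x <= 2 * b)%N by have := deg_le x; have := k2b x; lia.
have row_le (x : G) : (alpha + 1) * (degree x)%:R <= 2 * (alpha + 1) * b%:R.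
  have : (degree x)%:R <= 2 * b%:R :> R by rewrite -natrM ler_nat.
  by move: alpha_ge0; nra.
have [|le eqZ] := @rho_le_weight _ alpha G (fun=> 1) r G0 (fun=> ltr01).
  by move=> x; rewrite alpha_act1 mulr1; apply: le_trans (row_le x) _.
split=> // /eqZ[Z [/set0Pn[z zZ] Zcl rowZ]].
have degZ (x : G) : x \in Z -> degree x = (2 * b)%N /\ r = 2 * (alpha + 1) * b%:R.
  move=> /rowZ; rewrite alpha_act1 mulr1 => e.
  have re : r = 2 * (alpha + 1) * b%:R by have := row_le x; move: r_ge; lra.
  split=> //; apply/eqP; rewrite -(eqr_nat R) natrM; apply/eqP.
  have a1 : alpha + 1 != 0 by apply: lt0r_neq0; move: alpha_ge0; lra.
  by apply: (mulfI a1); rewrite e re; ring.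
split; first by have [] := degZ z zZ.
pose C := pblock P z.
have [zC CP] := andP (pblock_mem (xS z)).
have cC : #|C| = (2 * b + 1)%N.
  have := deg_le z; have := k2b z; have [-> _] := degZ z zZ.
  by rewrite /k -/C; lia.
have nbrC x : x \in Z -> x \in C -> [set y | adj x y] = C :\ x.
  move=> xZ xC; have [_ tI _] := and3P part.
  apply/eqP; rewrite eqEcard; apply/andP; split.
    have := nbr_outside (xS x); rewrite S0 setC0 setIT.
    by rewrite (def_pblock tI CP).
  by have := cardsD1 x C; rewrite xC; have [] := degZ x xZ; rewrite /degree; lia.
have CZ x : x \in C -> x \in Z.
  have [->//|xz] := eqVneq x z; move=> xC; apply: (Zcl z) => //.
  have : x \in C :\ z by rewrite !inE xz.
  by rewrite -(nbrC z) // inE.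
exists C => // x y; have [xC|xC] := boolP (x \in C).
  have := nbrC x (CZ x xC) xC; move=> /setP/(_ y); rewrite !inE eq_sym.
  by move=> ->.
(* An edge at [x] would give a second block with at least two vertices, but [C] already uses up all
   of [excess]. *)
rewrite andbF; apply/negP => xy.
have : (0 < degree x)%N by apply/card_gt0P; exists y; rewrite inE.
have [xB BP] := andP (pblock_mem (xS x)).
have BC : (pblock P x \in P) && (pblock P x != C).
  by rewrite BP; apply: contraNneq xC => <-.
move: excess (deg_le x); rewrite (bigD1 C CP) /= (bigD1 (pblock P x) BC) /=.
by rewrite cC /k; lia.
Qed.

Let s : R := #|S|%:R.
Let n : R := #|G|%:R.
Let D := r - alpha * s.

(** Outside [S] this is the solution [v] of [r * v = s * (alpha * v + 1) + k x * (alpha + 1) * v],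
    the row equation in a complete block joined to [S]. *)
Definition barrier_weight x : R :=
  if x \in S then 1 else s / (D - (alpha + 1) * (k x)%:R).
Local Notation w := barrier_weight.

Lemma weight_denominator x : (0 < #|S|)%N -> x \in ~: S ->
  (alpha + 2) * s <= D - (alpha + 1) * (k x)%:R.
Proof.
move=> s0 /k_le; rewrite -(ler_nat R) natrM natrB ?barrier_le // -/s => kx.
have : (alpha + 1) * (k x)%:R <= (alpha + 1) * (2 * (b%:R - s)).
  by apply: ler_wpM2l => //; move: alpha_ge0; lra.
rewrite /D; move: r_ge; lra.
Qed.

Lemma weight_row_outside x : (0 < #|S|)%N -> x \in ~: S ->
  alpha_act alpha w x <= r * w x /\
  (alpha_act alpha w x = r * w x -> forall y, y \in S -> adj x y).
Proof.
move=> s0 xS; have D0 := weight_denominator s0 xS.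
have s_gt0 : 0 < s by rewrite ltr0n.
have den : 0 < D - (alpha + 1) * (k x)%:R.
  by apply: lt_le_trans D0; rewrite mulr_gt0 //; move: alpha_ge0; lra.
set v := w x; have vE : v = s / (D - (alpha + 1) * (k x)%:R).
  by rewrite /v /w; move: xS; rewrite inE => /negPf ->.
have v0 : 0 < v by rewrite vE divr_gt0.
have rv : r * v = s * (alpha * v + 1) + (k x)%:R * ((alpha + 1) * v).
  have : v * (D - (alpha + 1) * (k x)%:R) = s by rewrite vE divfK // gt_eqF.
  by rewrite /D; lra.
(* Neighbours outside [S] lie in the block of [x], hence have the same weight [v]. *)
pose NS := [set y | adj x y] :&: S; pose NO := [set y | adj x y] :&: ~: S.
have -> : alpha_act alpha w x =
    #|NS|%:R * (alpha * v + 1) + #|NO|%:R * ((alpha + 1) * v).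
  rewrite /alpha_act -/v (bigID (fun y => y \in S)) /=; congr (_ + _).
    rewrite (eq_bigr (fun=> alpha * v + 1)); last first.
      by move=> y /andP[_ yS]; rewrite /w yS.
    rewrite sumr_const -[LHS]mulr_natl; congr (_%:R * _).
    by apply: eq_card => y; rewrite !inE.
  rewrite (eq_bigr (fun=> (alpha + 1) * v)); last first.
    move=> y /andP[xy yS]; rewrite /w (negPf yS) /k -(adjP xS) ?inE //.
    by rewrite -/(k x) -vE; ring.
  rewrite sumr_const -[LHS]mulr_natl; congr (_%:R * _).
  by apply: eq_card => y; rewrite !inE.
have NSle : #|NS|%:R <= s by rewrite ler_nat subset_leq_card // subsetIr.
have NOle : #|NO|%:R <= (k x)%:R :> R by rewrite ler_nat card_nbr_outside.
have c1 : 0 < alpha * v + 1 by rewrite ltr_wpDl // mulr_ge0 // ltW.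
have c2 : 0 <= (alpha + 1) * v by rewrite mulr_ge0 ?ltW //; move: alpha_ge0; lra.
have h2 : #|NO|%:R * ((alpha + 1) * v) <= (k x)%:R * ((alpha + 1) * v).
  exact: ler_wpM2r.
rewrite rv; split; first by rewrite lerD // ler_pM2r.
move=> e y yS; have : s * (alpha * v + 1) <= #|NS|%:R * (alpha * v + 1) by lra.
rewrite ler_pM2r // ler_nat => cNS.
have /eqP NSE : NS == S by rewrite eqEcard subsetIr cNS.
by move: yS; rewrite -NSE !inE => /andP[].
Qed.

Lemma weight_gt0 x : (0 < #|S|)%N -> 0 < w x.
Proof.
move=> s0; rewrite /w; case: ifPn => // xS.
have s_gt0 : 0 < s by rewrite ltr0n.
apply: divr_gt0 => //; apply: lt_le_trans (weight_denominator s0 _); rewrite ?inE //.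
by rewrite mulr_gt0 //; move: alpha_ge0; lra.
Qed.

(** The bound is the row of a vertex adjacent to all others. Each missing neighbour [y] costs
    [alpha + w y], which is positive. *)
Lemma weight_row_inside x : (0 < #|S|)%N -> x \in S ->
  alpha_act alpha w x <= alpha * (n - 1) + (s - 1) + \sum_(y in ~: S) w y /\
  (alpha_act alpha w x = alpha * (n - 1) + (s - 1) + \sum_(y in ~: S) w y ->
   forall y, y != x -> adj x y).
Proof.
move=> s0 xS.
have -> : alpha * (n - 1) + (s - 1) + \sum_(y in ~: S) w y =
    \sum_(y | y != x) (alpha + w y).
  rewrite big_split /= sumr_const -addrA; congr (_ + _).
    rewrite -[RHS]mulr_natr; congr (_ * _).
    have -> : #|[pred y | y != x]| = #|G|.-1 by rewrite -(cardC1 x); apply: eq_card.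
    have : (0 < #|G|)%N by apply/card_gt0P; exists x.
    by rewrite /n; case: #|G| => // m _; rewrite -natr1 addrK.
  rewrite [RHS](bigID (fun y => y \in S)) /=; congr (_ + _).
    rewrite (eq_bigr (fun=> 1)); last by move=> y /andP[_ yS]; rewrite /w yS.
    rewrite sumr_const /s (cardsD1 x) xS add1n -natr1 addrK; congr (_%:R).
    by apply: eq_card => y; rewrite !inE.
  apply: eq_bigl => y; rewrite inE andb_idl //.
  by apply: contraNneq => ->.
have -> : alpha_act alpha w x = \sum_(y | adj x y) (alpha + w y).
  by rewrite /alpha_act; apply: eq_bigr => y _; rewrite {1}/w xS mulr1.
have split_nbr : \sum_(y | y != x) (alpha + w y) =
    \sum_(y | adj x y) (alpha + w y) + \sum_(y | (y != x) && ~~ adj x y) (alpha + w y).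
  rewrite (bigID (fun y => adj x y)) /=; congr (_ + _); apply: eq_bigl => y.
  by rewrite andb_idl // => xy; apply: contraTneq xy => ->; rewrite adj_irrefl.
have pos y : 0 < alpha + w y by rewrite ltr_wpDl // weight_gt0.
rewrite split_nbr; split.
  by rewrite lerDl sumr_ge0 // => y _; rewrite ltW.
move=> e y yx; apply/negPn/negP => xy.
have : 0 < \sum_(y | (y != x) && ~~ adj x y) (alpha + w y).
  rewrite (bigD1 y) /= ?yx //; apply: ltr_wpDr => //.
  by rewrite sumr_ge0 // => z _; rewrite ltW.
by lra.
Qed.

(** If [|S| = b], all blocks are singletons and the comparison is the quadratic one; if [|S| < b],
    [weight_sum_lt] makes it strict. *)
Lemma weight_sum_bound : (0 < #|S|)%N -> (2 * b + 1 <= #|G|)%N ->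
  b%:R * (n - b%:R) <= (r - alpha * (n - 1) - (b%:R - 1)) * (r - alpha * b%:R) ->
  alpha * (n - 1) + (s - 1) + \sum_(x in ~: S) w x <= r ?= iff
    ((#|S| == b) && (b%:R * (n - b%:R) ==
      (r - alpha * (n - 1) - (b%:R - 1)) * (r - alpha * b%:R))).
Proof.
move=> s0 Gb ineq; apply/leifP.
have s_ge1 : 1 <= s by rewrite ler1n.
have sb : s <= b%:R by rewrite ler_nat barrier_le.
have nb : 2 * b%:R + 1 <= n by rewrite /n -natrM -[1]/(1%:R) -natrD ler_nat.
have card_out : (#|~: S|)%:R = n - s by rewrite /n /s -(cardsC S) natrD addrC addKr.
have wE x : x \in ~: S -> w x = s / (D - (alpha + 1) * (k x)%:R).
  by rewrite /w inE => /negPf ->.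
have [Sb|Sb] := eqVneq #|S| b.
  have sE : s = b%:R by rewrite /s Sb.
  have -> : \sum_(x in ~: S) w x = (n - s) * (s / D).
    rewrite (eq_bigr (fun=> s / D)) => [|x xS]; first by rewrite sumr_const -[_ *+ _]mulr_natl card_out.
    have := k_le xS; rewrite wE // Sb subnn muln0 leqn0 => /eqP ->.
    by rewrite mulr0 subr0.
  have D0 : 0 < D by rewrite /D; move: r_ge alpha_ge0; nra.
  rewrite /= -sE -/D.
  have -> : alpha * (n - 1) + (s - 1) + (n - s) * (s / D)
          = r + (s * (n - s) - (r - alpha * (n - 1) - (s - 1)) * D) / D.
    by field; rewrite gt_eqF.
  rewrite -sE in ineq; case: eqVneq => [->|ne]; first by rewrite subrr mul0r addr0.
  by rewrite gtrDl pmulr_llt0 ?invr_gt0 // subr_lt0 lt_neqAle ne ineq.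
apply: le_lt_trans (weight_sum_lt alpha_ge0 s_ge1 _ nb r_ge ineq); last first.
  by rewrite /s natr1 ler_nat ltn_neqAle Sb barrier_le.
set K := 2 * (b%:R - s); set E := D - (alpha + 1) * K.
have KE : (2 * (b - #|S|))%:R = K by rewrite natrM natrB ?barrier_le.
have E0 : 0 < E by rewrite /E /K /D; move: r_ge alpha_ge0; nra.
have DE : E <= D by rewrite /E /K gerBl mulr_ge0 //; move: alpha_ge0 sb; lra.
have D0 : 0 < D by lra.
(* A bound linear in [k x], so that [k_sum] applies: the excess of the weight over [s / D] is
   [s * c / (D * (D - c))], and [D - c] is at least [E]. *)
have w_le x : x \in ~: S -> w x <= s / D + s * (alpha + 1) / (D * E) * (k x)%:R.
  move=> xS; rewrite wE //; set c := (alpha + 1) * (k x)%:R.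
  have c0 : 0 <= c by rewrite mulr_ge0 //; move: alpha_ge0; lra.
  have cE : E <= D - c.
    rewrite /E /c lerD2l lerN2 ler_wpM2l //; first by move: alpha_ge0; lra.
    by rewrite -KE ler_nat k_le.
  have F0 : 0 < D - c by lra.
  have -> : s / (D - c) = s / D + s * c / (D * (D - c)).
    by field; rewrite !gt_eqF.
  have -> : s * (alpha + 1) / (D * E) * (k x)%:R = s * c / (D * E) by rewrite /c; ring.
  rewrite lerD2l.
  have sc : 0 <= s * c by rewrite mulr_ge0 //; lra.
  by rewrite ler_wpM2l // lef_pV2 ?posrE ?mulr_gt0 // ler_pM2l.
have : \sum_(x in ~: S) w x <= (n - s) * s / D + s * (alpha + 1) / (D * E) * (K * (K + 1)).
  apply: le_trans (ler_sum _ w_le) _.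
  rewrite big_split /= sumr_const -[_ *+ _]mulr_natl card_out -mulr_sumr mulrA lerD2l.
  apply: ler_wpM2l; first by rewrite divr_ge0 ?mulr_ge0 //; move: alpha_ge0; lra.
  by rewrite -natr_sum -KE natr1 -natrM ler_nat k_sum.
rewrite -/D -/K -/E; lra.
Qed.

Lemma rho_barrier : (0 < #|S|)%N -> (2 * b + 1 <= #|G|)%N ->
  b%:R * (n - b%:R) <= (r - alpha * (n - 1) - (b%:R - 1)) * (r - alpha * b%:R) ->
  rho alpha G <= r /\
  (rho alpha G = r ->
   b%:R * (n - b%:R) = (r - alpha * (n - 1) - (b%:R - 1)) * (r - alpha * b%:R) /\
   exists2 S : {set G}, #|S| = b &
     forall x y, adj x y = (x != y) && ((x \in S) || (y \in S))).
Proof.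
move=> s0 Gb ineq; have [sum_le sum_eq] := weight_sum_bound s0 Gb ineq.
have G0 : (0 < #|G|)%N by lia.
have wS x : x \in S -> w x = 1 by rewrite /w => ->.
have [|le eqZ] := @rho_le_weight _ alpha G w r G0 (fun x => weight_gt0 x s0).
  move=> x; have [xS|xS] := boolP (x \in S).
    by rewrite wS // mulr1; have [h _] := weight_row_inside s0 xS; apply: le_trans sum_le.
  by have [] := @weight_row_outside x s0; rewrite ?inE.
split=> // /eqZ[Z [/set0Pn[z zZ] Zcl rowZ]].
(* A tight row outside [S] belongs to a vertex adjacent to all of [S], so [Z] meets [S]. A tight row
   in [S] belongs to a vertex adjacent to all others, so [Z] will contain every vertex. *)
have [y yS yZ] : exists2 y, y \in S & y \in Z.
  have [zS|zS] := boolP (z \in S); first by exists z.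
  have /card_gt0P[y yS] := s0; exists y => //; apply: (Zcl z) => //.
  have [|_] := @weight_row_outside z s0; first by rewrite inE.
  by apply; rewrite ?rowZ.
have tight x : x \in S -> x \in Z ->
    alpha * (n - 1) + (s - 1) + \sum_(x in ~: S) w x = r /\
    forall y, y != x -> adj x y.
  move=> xS xZ; have [h h'] := weight_row_inside s0 xS.
  have e : alpha_act alpha w x = r by rewrite rowZ // wS // mulr1.
  by split; [lra | apply: h'; lra].
have [sumE yadj] := tight y yS yZ.
move: sum_eq; rewrite sumE eqxx => /esym/andP[/eqP Sb /eqP eqn].
have allZ x : x \in Z by have [->//|xy] := eqVneq x y; apply: (Zcl y); rewrite ?yadj.
split=> //; exists S => // u v; have [->|uv] := eqVneq u v; first exact: adj_irrefl.
have [uS|uS] /= := boolP (u \in S); first by have [_ ->] := tight u uS (allZ u); rewrite 1?eq_sym.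
have [vS|vS] := boolP (v \in S); first by rewrite adj_sym; have [_ ->] := tight v vS (allZ v).
(* As [|S| = b], every [k] vanishes and no edge avoids [S]. *)
apply/negP => adj_uv; have uS' : u \in ~: S by rewrite inE.
have := card_nbr_outside uS'; have := k_le uS'; rewrite Sb subnn.
have : (0 < #|[set y | adj u y] :&: ~: S|)%N by apply/card_gt0P; exists v; rewrite !inE adj_uv.
lia.
Qed.

End BarrierBounds.

(** * Upper bounds and the values at the extremal graphs *)

Section ExtremalValues.
Variables (R : realType) (alpha : R) (G : sgraph).

Lemma rho_le_barrier b r : 0 <= alpha -> (0 < b)%N -> matching_number G = b ->
  (2 * b + 1 <= #|G|)%N -> 2 * (alpha + 1) * b%:R <= r ->
  b%:R * (#|G|%:R - b%:R) <=
    (r - alpha * (#|G|%:R - 1) - (b%:R - 1)) * (r - alpha * b%:R) ->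
  rho alpha G <= r /\
  (rho alpha G = r ->
   (r = 2 * (alpha + 1) * b%:R /\ exists2 C : {set G}, #|C| = (2 * b + 1)%N &
     forall x y, adj x y = [&& x != y, x \in C & y \in C]) \/
   (b%:R * (#|G|%:R - b%:R) =
      (r - alpha * (#|G|%:R - 1) - (b%:R - 1)) * (r - alpha * b%:R) /\
    exists2 S : {set G}, #|S| = b &
     forall x y, adj x y = (x != y) && ((x \in S) || (y \in S)))).
Proof.
move=> a0 b0 Gb nb rb ineq; have [S [P [part adjP]]] := barrier G.
rewrite Gb => excess; have [S0|S0] := eqVneq S set0.
  have [|le eq] := rho_barrier0 a0 rb part adjP excess _ b0 S0; first by lia.
  by split=> // /eq; left.
rewrite -card_gt0 in S0.
have [le eq] := rho_barrier a0 rb part adjP excess S0 nb ineq.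
by split=> // /eq; right.
Qed.

(** Weight 1 again. A tight row belongs to a vertex adjacent to all others, which brings every
    vertex into [Z]. *)
Lemma rho_le_order : 0 <= alpha -> (0 < #|G|)%N ->
  rho alpha G <= (alpha + 1) * (#|G|%:R - 1) /\
  (rho alpha G = (alpha + 1) * (#|G|%:R - 1) <->
   forall x y : G, adj x y = (x != y)).
Proof.
move=> a0 G0; have a1 : 0 < alpha + 1 by lra.
have nE : #|G|%:R - 1 = #|G|.-1%:R :> R by case: #|G| G0 => // m _; rewrite -natr1 addrK.
have nbr x : [set y | adj x y] \subset [set~ x].
  by apply/subsetP => y; rewrite !inE; apply: contraTneq => ->; rewrite adj_irrefl.
have deg_le x : (@degree G x <= #|G|.-1)%N by rewrite -(cardsC1 x) subset_leq_card.
have [|le eqZ] := @rho_le_weight _ alpha G (fun=> 1) ((alpha + 1) * (#|G|%:R - 1)) G0 (fun=> ltr01).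
  by move=> x; rewrite alpha_act1 mulr1 nE ler_pM2l // ler_nat.
split=> //; split=> [/eqZ[Z [/set0Pn[z zZ] Zcl rowZ]]|adjE]; last first.
  apply: (rho_eq (phi := fun=> 1)) => //.
    by have /card_gt0P[x _] := G0; exists x; rewrite oner_neq0.
  move=> x; rewrite alpha_act1 mulr1 nE /degree -(cardsC1 x); congr (_ * _%:R).
  by apply: eq_card => y; rewrite !inE adjE eq_sym.
have adj_dominating x y : x \in Z -> adj x y = (x != y).
  move=> /rowZ; rewrite alpha_act1 mulr1 nE => /(mulfI (lt0r_neq0 a1)) /eqP.
  rewrite eqr_nat => /eqP deg.
  have /eqP/setP/(_ y) : [set y | adj x y] == [set~ x].
    by rewrite eqEcard nbr cardsC1 -deg leqnn.
  by rewrite !inE eq_sym.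
move=> x y; apply: (adj_dominating); have [->//|xz] := eqVneq x z.
by apply: (Zcl z) => //; rewrite adj_dominating 1?eq_sym.
Qed.

Lemma rho_complete_union b : 0 <= alpha -> (0 < b)%N ->
  rho alpha G <= 2 * (alpha + 1) * b%:R ->
  (exists2 C : {set G}, #|C| = (2 * b + 1)%N &
     forall x y, adj x y = [&& x != y, x \in C & y \in C]) ->
  rho alpha G = 2 * (alpha + 1) * b%:R.
Proof.
move=> a0 b0 le [C cC adjE].
apply: (rho_eq (phi := fun x => (x \in C)%:R)) => //.
  have /card_gt0P[x xC] : (0 < #|C|)%N by lia.
  by exists x; rewrite xC oner_neq0.
move=> x; have [xC|xC] := boolP (x \in C); last first.
  rewrite mulr0 /alpha_act big1 // => y.
  by rewrite adjE (negPf xC) andbF.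
rewrite /alpha_act xC (eq_bigr (fun=> alpha + 1)) => [|y]; last first.
  by rewrite adjE => /and3P[_ _ ->]; rewrite mulr1.
rewrite sumr_const (_ : #|_| = (2 * b)%N); first by rewrite -[_ *+ (2 * b)]mulr_natr natrM /=; ring.
have := cardsD1 x C; rewrite xC cC addn1 add1n => /succn_inj ->.
by apply: eq_card => y; rewrite -[LHS]/(adj x y) !inE adjE xC eq_sym.
Qed.

Lemma rho_complete_join b r : 0 <= alpha -> (0 < b < #|G|)%N ->
  2 * (alpha + 1) * b%:R <= r ->
  b%:R * (#|G|%:R - b%:R) =
    (r - alpha * (#|G|%:R - 1) - (b%:R - 1)) * (r - alpha * b%:R) ->
  rho alpha G <= r ->
  (exists2 S : {set G}, #|S| = b &
     forall x y, adj x y = (x != y) && ((x \in S) || (y \in S))) ->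
  rho alpha G = r.
Proof.
move=> a0 /andP[b0 bG] rb eqn le [S cS adjE].
(* This is [barrier_weight] with singleton blocks, multiplied by [r - alpha * b]. *)
pose phi x := if x \in S then r - alpha * b%:R else b%:R.
have b_gt0 : 0 < b%:R :> R by rewrite ltr0n.
have card_out : #|~: S|%:R = #|G|%:R - b%:R :> R.
  by rewrite -(cardsC S) cS natrD addrC addKr.
apply: (rho_eq (phi := phi)) => //.
  have /card_gt0P[x xS] : (0 < #|S|)%N by rewrite cS.
  exists x; rewrite /phi xS; apply: lt0r_neq0; nra.
move=> x; rewrite /alpha_act; have [xS|xS] := boolP (x \in S); last first.
  rewrite (eq_bigl [in S]) => [|y].
    rewrite (eq_bigr (fun=> r)) => [|y yS]; last by rewrite /phi yS (negPf xS); ring.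
    by rewrite sumr_const cS -mulr_natr /phi (negPf xS).
  by rewrite adjE (negPf xS) /= andb_idl // => yS; apply: contraNneq xS => ->.
rewrite (eq_bigl (fun y => y != x)) => [|y]; last by rewrite adjE xS andbT eq_sym.
(* The sum over all vertices is simpler; the term of [x] is taken off at the end. *)
have total : \sum_y (alpha * phi x + phi y) =
    #|G|%:R * (alpha * phi x) + b%:R * phi x + (#|G|%:R - b%:R) * b%:R.
  rewrite big_split /= sumr_const -[_ *+ _]mulr_natl -addrA; congr (_ + _).
  rewrite (bigID [in S]) /=; congr (_ + _).
    rewrite (eq_bigr (fun=> phi x)) => [|y yS]; last by rewrite /phi yS xS.
    by rewrite sumr_const cS -[_ *+ b]mulr_natl.
  rewrite (eq_bigl [in ~: S]) => [|y]; last by rewrite !inE.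
  rewrite (eq_bigr (fun=> b%:R)) => [|y]; last by rewrite inE /phi => /negPf ->.
  by rewrite sumr_const -[_ *+ _]mulr_natl card_out.
move: total; rewrite (bigD1 x) //= => total.
apply: (addrI (alpha * phi x + phi x)); rewrite total [_ * b%:R]mulrC eqn.
rewrite /phi xS; ring.
Qed.

End ExtremalValues.

(** * The four ranges of the order *)

Theorem theorem1p1 (R : realType) (alpha : R) (n beta : nat) (G : sgraph)
    (alpha_ge0 : 0 <= alpha) (n_gt0 : (0 < n)%N) (beta_gt0 : (0 < beta)%N)
    (G_order : order_of G = n) (G_matching : matching_number G = beta) :
  [/\ (n = 2 * beta \/ n = 2 * beta + 1)%N ->
        rho alpha G <= (alpha + 1) * (n%:R - 1) /\
        (rho alpha G = (alpha + 1) * (n%:R - 1) <->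
           graph_iso G (complete_graph n)),
      (2 * beta + 2 <= n)%N ->
      n%:R < ((2 * alpha + 3) * beta%:R + alpha + 2) / (alpha + 1) ->
        rho alpha G <= 2 * (alpha + 1) * beta%:R /\
        (rho alpha G = 2 * (alpha + 1) * beta%:R <->
           graph_iso G (graph_union (complete_graph (2 * beta + 1))
                                    (edgeless_graph (n - 2 * beta - 1)))),
      n%:R = ((2 * alpha + 3) * beta%:R + alpha + 2) / (alpha + 1) ->
        rho alpha G <= 2 * (alpha + 1) * beta%:R /\
        (rho alpha G = 2 * (alpha + 1) * beta%:R <->
           graph_iso G (graph_join (complete_graph beta)
                                   (edgeless_graph (n - beta))) \/
           graph_iso G (graph_union (complete_graph (2 * beta + 1))
                                    (edgeless_graph (n - 2 * beta - 1))))
    & n%:R > ((2 * alpha + 3) * beta%:R + alpha + 2) / (alpha + 1) ->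
        let b := alpha * n%:R + (alpha + 1) * beta%:R - (alpha + 1) in
        let c := (alpha ^+ 2 - 1) * beta%:R * n%:R
                 + (alpha + 1) * beta%:R ^+ 2
                 - alpha * (alpha + 1) * beta%:R in
        let bound := (b + Num.sqrt (b ^+ 2 - 4 * c)) / 2 in
        rho alpha G <= bound /\
        (rho alpha G = bound <->
           graph_iso G (graph_join (complete_graph beta)
                                   (edgeless_graph (n - beta))))].
Proof.
have cardG : #|G| = n by [].
have a1 : 0 < alpha + 1 by lra.
have b1 : 1 <= beta%:R :> R by rewrite ler1n.
pose r0 := 2 * (alpha + 1) * beta%:R : R.
(* At [r0] the slack of the quadratic condition has the sign of the threshold minus [n], which
   separates the last three cases. *)
have gap : (r0 - alpha * (n%:R - 1) - (beta%:R - 1)) * (r0 - alpha * beta%:R) =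
    beta%:R * (n%:R - beta%:R) + beta%:R * (alpha + 1) *
      ((2 * alpha + 3) * beta%:R + alpha + 2 - n%:R * (alpha + 1)).
  by rewrite /r0; ring.
have gap0 : 0 < beta%:R * (alpha + 1) by rewrite mulr_gt0 //; lra.
have isoJ : (beta <= n)%N -> graph_iso G (graph_join (complete_graph beta)
     (edgeless_graph (n - beta))) <-> exists2 S : {set G}, #|S| = beta &
       forall x y, adj x y = (x != y) && ((x \in S) || (y \in S)).
  by move=> bn; apply: complete_join_isoP; rewrite cardG; lia.
have isoU : (2 * beta + 1 <= n)%N -> graph_iso G (graph_union
     (complete_graph (2 * beta + 1)) (edgeless_graph (n - 2 * beta - 1))) <->
     exists2 C : {set G}, #|C| = (2 * beta + 1)%N &
       forall x y, adj x y = [&& x != y, x \in C & y \in C].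
  by move=> bn; apply: complete_union_isoP; rewrite cardG; lia.
(* The threshold equals [2 * beta + 1 + (beta + 1) / (alpha + 1)]. *)
have large : ((2 * alpha + 3) * beta%:R + alpha + 2) / (alpha + 1) <= n%:R ->
    (2 * beta + 1 <= n)%N.
  rewrite ler_pdivrMr // => h; rewrite -(ler_nat R) natrD natrM.
  by rewrite -(ler_pM2r a1); lra.
split.
- move=> _; have := @rho_le_order R alpha G alpha_ge0; rewrite cardG => /(_ n_gt0)[le eqn].
  by split=> //; split=> [/eqn|] /(complete_isoP cardG) // /eqn.
- move=> nb; rewrite ltr_pdivlMr // => lt.
  have nb1 : (2 * beta + 1 <= n)%N by lia.
  have {}isoU := isoU nb1.
  have ineq : beta%:R * (n%:R - beta%:R) <
      (r0 - alpha * (n%:R - 1) - (beta%:R - 1)) * (r0 - alpha * beta%:R).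
    by rewrite gap ltrDl mulr_gt0 // subr_gt0.
  have := @rho_le_barrier R alpha G beta r0 alpha_ge0 beta_gt0 G_matching.
  rewrite cardG => /(_ nb1 (lexx _) (ltW ineq))[le eqn].
  split=> //; split=> [/eqn[[_ /isoU]|[e]]|/isoU h].
  + by [].
  + by rewrite e ltxx in ineq.
  + exact: rho_complete_union.
- move=> nT; have nb1 : (2 * beta + 1 <= n)%N by apply: large; rewrite nT.
  have {}isoU := isoU nb1; have {}isoJ : _ <-> _ := isoJ ltac:(lia).
  have ineq : beta%:R * (n%:R - beta%:R) =
      (r0 - alpha * (n%:R - 1) - (beta%:R - 1)) * (r0 - alpha * beta%:R).
    by rewrite gap {3}nT divfK ?lt0r_neq0 // subrr mulr0 addr0.
  have := @rho_le_barrier R alpha G beta r0 alpha_ge0 beta_gt0 G_matching.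
  rewrite cardG => /(_ nb1 (lexx _)); rewrite {1}ineq => /(_ (lexx _))[le eqn].
  split=> //; split=> [/eqn[[_ /isoU]|[_ /isoJ]]|[/isoJ|/isoU] h].
  + by right.
  + by left.
  + by apply: (@rho_complete_join _ _ _ beta); rewrite ?cardG //; lia.
  + exact: rho_complete_union.
move=> nT b c bound; have nb1 := large (ltW nT).
have {}isoJ : _ <-> _ := isoJ ltac:(lia).
move: nT; rewrite ltr_pdivrMr // => nT.
have nb1R : 2 * beta%:R + 1 <= n%:R :> R by rewrite -natrM -[1]/(1%:R) -natrD ler_nat.
have disc : 0 <= b ^+ 2 - 4 * c.
  have -> : b ^+ 2 - 4 * c =
    (alpha * (n%:R - 1) + (beta%:R - 1) - alpha * beta%:R) ^+ 2 +
      4 * (beta%:R * (n%:R - beta%:R)) by rewrite /b /c; ring.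
  by rewrite addr_ge0 ?sqr_ge0 // !mulr_ge0 //; lra.
(* [bound] is the larger root of the quadratic; the other one is [bound] minus the square root. *)
have quad x : (x - alpha * (n%:R - 1) - (beta%:R - 1)) * (x - alpha * beta%:R) -
    beta%:R * (n%:R - beta%:R) = (x - bound) * (x - bound + Num.sqrt (b ^+ 2 - 4 * c)).
  have : Num.sqrt (b ^+ 2 - 4 * c) ^+ 2 = b ^+ 2 - 4 * c by rewrite sqr_sqrtr.
  rewrite /bound; set q := Num.sqrt _ => qE.
  have -> : (x - (b + q) / 2) * (x - (b + q) / 2 + q) = (x - b / 2) ^+ 2 - q ^+ 2 / 4 by field.
  by rewrite qE /b /c; field.
(* The quadratic is nonnegative from its larger root on, but negative at [r0] by [gap]. Strictness
   also rules out the clique with isolated vertices. *)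
have r0_lt : r0 < bound.
  rewrite ltNge; apply/negP => le.
  have : 0 <= (r0 - bound) * (r0 - bound + Num.sqrt (b ^+ 2 - 4 * c)).
    have d : 0 <= r0 - bound by rewrite subr_ge0.
    by rewrite mulr_ge0 //; apply: addr_ge0 => //; apply: sqrtr_ge0.
  rewrite -quad gap addrC addKr pmulr_rge0 //; lra.
have eqn : beta%:R * (n%:R - beta%:R) =
    (bound - alpha * (n%:R - 1) - (beta%:R - 1)) * (bound - alpha * beta%:R).
  by have := quad bound; rewrite subrr mul0r => /subr0_eq.
have := @rho_le_barrier R alpha G beta bound alpha_ge0 beta_gt0 G_matching.
rewrite cardG => /(_ nb1 (ltW r0_lt)); rewrite {1}eqn => /(_ (lexx _))[le eqr].
split=> //; split=> [/eqr[[e]|[_ /isoJ]]|/isoJ h].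
- by move: r0_lt; rewrite e ltxx.
- by [].
- apply: (@rho_complete_join _ _ _ beta) => //; rewrite ?cardG ?ltW //; by lia.
Qed.
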